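(* Let $R$ be an integral domain, and let $M$ be a positive monoid. If $M$ is weak-ACCP, then so is the localization of $R[M]$ at the multiplicative subset $\{f \in R[M] \mid f(0) \neq 0\}$.
   Context: A positive monoid is an additive submonoid of $\mathbb{R}_{\ge 0}$. $R[M]$ is the monoid ring of polynomial expressions $\sum_i r_i X^{m_i}$ with coefficients $r_i\in R$ and exponents $m_i\in M$; it is an integral domain here, and $f(0)$ denotes the coefficient of $X^0$ in $f$. Weak-ACCP for monoids: for an additive commutative cancellative monoid $M$, $b$ divides $c$ if $c=b+b'$ for some $b'\in M$, and then $c-b$ denotes $b'$. An atom is a non-invertible $a\in M$ such that $a=u+v$ with $u,v\in M$ implies $u$ or $v$ is invertible; $M$ is atomic if every non-invertible element is a sum of atoms. An element $b\in M$ satisfies ACCP if every ascending chain of principal ideals (sets of the form $c+M$) starting at $b+M$ eventually stabilizes. $M$ is weak-ACCP if it is atomic and every nonempty finite subset $S$ of $M$ has a common divisor $d\in M$ such that $s-d$ satisfies ACCP for some $s\in S$. An integral domain is weak-ACCP if its multiplicative monoid of nonzero elements is weak-ACCP; that is, it is atomic (every nonzero nonunit is a finite product of irreducibles) and every nonempty finite set $S$ of nonzero elements has a common divisor $d$ such that, for some $s\in S$, every ascending chain of principal ideals starting at the ideal generated by $\frac{s}{d}$ eventually stabilizes. *)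

(* Defs.v *)
From HB Require Import structures.
From mathcomp Require Import all_boot all_order all_algebra finmap.
From mathcomp Require Import boolp classical_sets cardinality reals.
From mathcomp Require Import monalg.

Set Implicit Arguments.
Unset Strict Implicit.
Unset Printing Implicit Defensive.

Import Order.TTheory GRing.Theory Num.Theory.

Local Open Scope classical_set_scope.
Local Open Scope ring_scope.

(* Divisibility theory of a commutative monoid, given by its operation [op] and
   its identity [e].  It is used below for the exponent monoid (written
   additively) and for the nonzero elements of a domain (written
   multiplicatively); both are cancellative, so that the cofactor [b'] of a
   divisor is unique there. *)
Section CommutativeMonoid.
Context {T : choiceType} {e : T} (op : Monoid.com_law e).

Definition invertible (x : T) : Prop := exists y, op x y = e.

Definition divides (b c : T) : Prop := exists b', c = op b b'.

Definition atom (a : T) : Prop :=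
  ~ invertible a /\ forall u v, a = op u v -> invertible u \/ invertible v.

Definition atomic : Prop :=
  forall x, ~ invertible x ->
  exists2 s : seq T, (forall a, a \in s -> atom a) & x = \big[op/e]_(a <- s) a.

Definition principal_ideal (c : T) : set T := range (op c).

Definition satisfies_ACCP (b : T) : Prop :=
  forall c : nat -> T,
  principal_ideal (c 0%N) = principal_ideal b ->
  (forall n, principal_ideal (c n) `<=` principal_ideal (c n.+1)) ->
  exists N, forall n, (N <= n)%N -> principal_ideal (c n) = principal_ideal (c N).

(* In [s = op d s'], the element [s'] is the difference "s - d" (additively) or
   the quotient "s / d" (multiplicatively). *)
Definition weak_ACCP : Prop :=
  atomic /\
  forall S : set T, finite_set S -> S !=set0 ->
  exists2 d, (forall s, S s -> divides d s) &
  exists s s', [/\ S s, s = op d s' & satisfies_ACCP s'].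

End CommutativeMonoid.

Section NonzeroMonoid.
Context (D : idomainType).

Definition nonzero := {x : D | x != 0}.
HB.instance Definition _ := Choice.on nonzero.

Definition nonzero_one : nonzero := exist _ 1 (oner_neq0 D).

Definition nonzero_mul (x y : nonzero) : nonzero :=
  exist _ (val x * val y) (mulf_neq0 (valP x) (valP y)).

Fact nonzero_mulA : associative nonzero_mul.
Proof. by move=> x y z; apply: val_inj; rewrite /= mulrA. Qed.

Fact nonzero_mulC : commutative nonzero_mul.
Proof. by move=> x y; apply: val_inj; rewrite /= mulrC. Qed.

Fact nonzero_mul1 : left_id nonzero_one nonzero_mul.
Proof. by move=> x; apply: val_inj; rewrite /= mul1r. Qed.

HB.instance Definition _ := Monoid.isComLaw.Build nonzero nonzero_one
  nonzero_mul nonzero_mulA nonzero_mulC nonzero_mul1.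

End NonzeroMonoid.

Definition weak_ACCP_domain (D : idomainType) : Prop :=
  weak_ACCP (@nonzero_mul D).

(* A classical unit structure on a commutative ring, in the form expected by
   [GRing.ComNzRing_hasMulInverse]. *)
Section ClassicalInverse.
Context (A : comNzRingType).

Definition classical_unit : {pred A} := fun x => `[< exists y, y * x = 1 >].

Definition classical_inv (x : A) : A :=
  if pselect (exists y, y * x = 1) is left xU then projT1 (cid xU) else x.

Fact classical_mulVx : {in classical_unit, left_inverse 1 classical_inv *%R}.
Proof.
move=> x /asboolP xU; rewrite /classical_inv.
by case: pselect => // xU'; case: cid.
Qed.

Fact classical_unitPl (x y : A) : y * x = 1 -> classical_unit x.
Proof. by move=> yx1; apply/asboolP; exists y. Qed.

Fact classical_inv_out : {in [predC classical_unit], classical_inv =1 id}.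
Proof.
move=> x; rewrite /classical_inv; case: pselect => //= xU /negP[].
exact/asboolP.
Qed.

End ClassicalInverse.

Record positive_monoid (K : realType) := PositiveMonoid {
  pm_pred :> {pred K};
  pm_closed : addr_closed pm_pred;
  pm_ge0 : {in pm_pred, forall x, 0 <= x} }.

Section PositiveMonoid.
Context (K : realType) (M : positive_monoid K).

Definition exponent := {x : K | pm_pred M x}.
HB.instance Definition _ := SubChoice.on exponent.
HB.instance Definition _ := 
  GRing.SubChoice_isSubNmodule.Build K (pm_pred M) exponent (pm_closed M).

Fact exponent_add_eq0 (x y : exponent) : x + y = 0 -> x = 0 /\ y = 0.
Proof.
move=> /(congr1 val); rewrite raddfD raddf0 => /eqP.
rewrite paddr_eq0 ?(pm_ge0 (valP _)) //.
by case/andP=> /eqP x0 /eqP y0; split; apply: val_inj; rewrite raddf0.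
Qed.

(* [monalg] writes the monoid of exponents multiplicatively. *)
HB.instance Definition _ := Choice_isMonomialDef.Build exponent
  (@addrA exponent) (@add0r exponent) (@addr0 exponent) exponent_add_eq0.
HB.instance Definition _ := MonomialDef_isConomialDef.Build exponent
  (@addrC exponent).

End PositiveMonoid.

Section MonoidRing.
Context (D : idomainType) (K : realType) (M : positive_monoid K).

Definition monoid_ring := {malg D[exponent M]}.
HB.instance Definition _ := GRing.ComNzRing.on monoid_ring.

HB.instance Definition _ := GRing.ComNzRing_hasMulInverse.Build monoid_ring
  (@classical_mulVx monoid_ring) (@classical_unitPl monoid_ring)
  (@classical_inv_out monoid_ring).

Fact msupp_min (f : monoid_ring) : f != 0 ->
  exists2 k, k \in msupp f & forall l, l \in msupp f -> val k <= val l :> K.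
Proof.
rewrite -msupp_eq0 => /fset0Pn[k0 fk0].
case: (@arg_minP _ _ (msupp f) [` fk0]%fset xpredT (fun i => val (val i))) => //.
move=> k _ kmin; exists (val k) => [|l fl]; first exact: valP.
exact: (kmin [` fl]%fset).
Qed.

Fact monoid_ring_integral : GRing.integral_domain_axiom monoid_ring.
Proof.
move=> f g fg0; apply/norP => -[/msupp_min[k fk kmin] /msupp_min[l gl lmin]].
have: (f * g)@_(k + l) != 0; last by rewrite fg0 mcoeff0 eqxx.
rewrite mcoeffMl (big_fsetD1 k) //= (big_fsetD1 l) //= eqxx mulr1n.
have addE (i j : exponent M) : val (i + j) = val i + val j :> K by [].
rewrite !big_seq !big1 ?addr0.
- by rewrite mulf_neq0 // mcoeff_neq0.
- move=> i /fsetD1P[ik fi]; rewrite big_seq big1 // => j gj.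
  case: eqP => // /(congr1 val); rewrite !addE => ij; case/eqP: ik.
  apply: val_inj; apply/le_anti; rewrite kmin // andbT.
  by rewrite -(lerD2r (val j)) ij lerD2l lmin.
move=> j /fsetD1P[jl gj]; case: eqP => // /(congr1 val); rewrite !addE.
by move=> /addrI /val_inj jl'; rewrite jl' eqxx in jl.
Qed.

HB.instance Definition _ :=
  GRing.ComUnitRing_isIntegral.Build monoid_ring monoid_ring_integral.

End MonoidRing.

Record multiplicative_subset (D : idomainType) := MultiplicativeSubset {
  ms_pred :> {pred D};
  ms_closed : mulr_closed ms_pred;
  ms_neq0 : 0 \notin ms_pred }.

(* The localization of a domain [D] at [S], realized as the subring of the
   fractions [f / s] with [s \in S] in the field of fractions of [D]. *)
Section Localization.
Context (D : idomainType) (S : multiplicative_subset D).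

Local Notation "x %:F" := (FracField.tofrac x).

Definition localization_pred : {pred {fraction D}} :=
  fun x => `[< exists f s, s \in ms_pred S /\ x = f%:F / s%:F >].

Fact ms_frac_neq0 (s : D) : s \in ms_pred S -> s%:F != 0.
Proof.
by move=> Ss; rewrite tofrac_eq0; apply: contraTneq Ss => ->; exact: ms_neq0.
Qed.

Fact localization_closed : subring_closed localization_pred.
Proof.
have [S1 SM] := ms_closed S; split.
- by apply/asboolP; exists 1, 1; rewrite S1 rmorph1 divr1.
- move=> _ _ /asboolP[f [s [Ss ->]]] /asboolP[g [t [St ->]]].
  apply/asboolP; exists (f * t - g * s), (s * t); split; first exact: SM.
  by rewrite -mulNr addf_div ?ms_frac_neq0 // mulNr rmorphB !rmorphM.
- move=> _ _ /asboolP[f [s [Ss ->]]] /asboolP[g [t [St ->]]].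
  apply/asboolP; exists (f * g), (s * t); split; first exact: SM.
  by rewrite !rmorphM mulf_div.
Qed.

Definition localization := {x : {fraction D} | localization_pred x}.
HB.instance Definition _ := SubChoice.on localization.
HB.instance Definition _ := GRing.SubChoice_isSubComNzRing.Build {fraction D}
  localization_pred localization localization_closed.

HB.instance Definition _ := GRing.ComNzRing_hasMulInverse.Build localization
  (@classical_mulVx localization) (@classical_unitPl localization)
  (@classical_inv_out localization).

Fact localization_integral : GRing.integral_domain_axiom localization.
Proof.
move=> x y /(congr1 val) /eqP; rewrite rmorphM rmorph0 mulf_eq0.
by rewrite -(rmorph0 (val : localization -> _)) !(inj_eq val_inj).
Qed.

HB.instance Definition _ :=
  GRing.ComUnitRing_isIntegral.Build localization localization_integral.

End Localization.

Section NonzeroConstantTerm.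
Context (D : idomainType) (K : realType) (M : positive_monoid K).

Definition nonzero_constant_term_pred : {pred monoid_ring D M} :=
  fun f => f@_(0 : exponent M) != 0.

Fact nonzero_constant_term_closed : mulr_closed nonzero_constant_term_pred.
Proof.
split=> [|f g]; rewrite !unfold_in /nonzero_constant_term_pred.
  by rewrite (rmorph1 (mcoeff (mone : exponent M))) oner_neq0.
rewrite (rmorphM (mcoeff (mone : exponent M))) /= => f0 g0.
exact: mulf_neq0.
Qed.

Fact nonzero_constant_term_neq0 : 0 \notin nonzero_constant_term_pred.
Proof. by rewrite unfold_in /nonzero_constant_term_pred mcoeff0 eqxx. Qed.

Definition nonzero_constant_term : multiplicative_subset (monoid_ring D M) :=
  MultiplicativeSubset nonzero_constant_term_closed nonzero_constant_term_neq0.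

End NonzeroConstantTerm.

(* Main.v *)
Require Import Defs.
From mathcomp Require Import all_boot all_order all_algebra finmap.
From mathcomp Require Import boolp classical_sets cardinality reals.
From mathcomp Require Import monalg ring.

(** Write [L] for the localization.  A fraction is a unit of [L] as soon as [0]
   lies in the support of its numerator, and every element of [L] is a unit
   times (the image of) a polynomial expression.

   Divisibility in [L] is visible on supports: if [g] divides [f] in [L], then
   every exponent of [f] has a divisor among the exponents of [g]
   ([msupp_divides]).  Indeed [s f = p g] with [s(0) <> 0], and an exponent of
   [f] that no other exponent of [f] divides cannot be cancelled in [s f].

   The heart of the proof is [msupp_ACCP]: if some exponent [a] of [f] satisfies
   ACCP in [M], then [f] satisfies ACCP in [L].  Given a chain of divisors of
   [f] with successive quotients [h_0, h_1, ...], each product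
   [h_0 ... h_(n-1)] divides [f], so for each [n] some sum
   [x_0 + ... + x_(n-1)] with [x_i] an exponent of [h_i] divides [a].  Supports
   are finite, so by Koenig's lemma a single infinite sequence [x] works for
   all [n] ([msupp_prod_chain]).  It gives a chain of divisors of [a] in [M],
   which stabilizes: almost all [x_i] are [0], hence almost all [h_i] are units.

   Now let [S] be a finite nonempty set of nonzero elements of [L].  The
   supports of their numerators have a finite union; a weak-ACCP common divisor
   [d] of it in [M] makes [X^d] a common divisor of [S], with a cofactor that
   has an exponent satisfying ACCP, hence satisfies ACCP itself
   ([exists_ACCP_cofactor]).  For [S = {x}] this reads [x = X^d y]: the factor
   [y] is a unit or a product of atoms because it satisfies ACCP, and [X^d] is a
   product of atoms because [M] is atomic and atoms of [M] give atoms of [L]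
   ([atom_monomial]).  So [L] is atomic too. *)

Set Implicit Arguments.
Unset Strict Implicit.
Unset Printing Implicit Defensive.

Import Order.TTheory GRing.Theory Num.Theory.

Local Open Scope classical_set_scope.
Local Open Scope ring_scope.

(** * Ascending chains in cancellative monoids *)

Section CancellativeMonoid.
Context {T : choiceType} {e : T} (op : Monoid.com_law e).
Context (opI : forall x, injective (op x)).

Local Lemma opA : associative op. Proof. exact: Monoid.mulmA. Qed.
Local Lemma opC : commutative op. Proof. exact: Monoid.mulmC. Qed.
Local Lemma op1x : left_id e op. Proof. exact: Monoid.mul1m. Qed.
Local Lemma opx1 : right_id e op. Proof. exact: Monoid.mulm1. Qed.

Lemma principal_idealS c d :
  principal_ideal op c `<=` principal_ideal op d <-> divides op d c.
Proof.
split=> [/(_ c)|[b ->] _ [x _ <-]].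
  by case=> [|b _ <-]; [exists e; rewrite ?opx1 | exists b].
by exists (op b x); rewrite ?opA.
Qed.

Lemma principal_ideal_invertible c u :
  principal_ideal op (op c u) = principal_ideal op c <-> invertible op u.
Proof.
split=> [/seteqP[_ /principal_idealS[v]]|[v uv]].
  rewrite -{1}(opx1 c) -opA => /opI uv.
  by exists v; rewrite -uv.
apply/seteqP; split; apply/principal_idealS; first by exists u.
by exists v; rewrite -opA uv opx1.
Qed.

(** Replacing the chain of ideals by a sequence of successive quotients gets rid
   of the choice of generators, in particular of the first one. *)
Lemma satisfies_ACCPP b :
  satisfies_ACCP op b <->
  forall c q : nat -> T, c 0%N = b -> (forall n, c n = op (c n.+1) (q n)) ->
  exists N, forall n, (N <= n)%N -> invertible op (q n).
Proof.
split=> [bP c q c0 cq|bP c c0 cS].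
  case: (bP c) => [|n|N NP]; first by rewrite c0.
    by apply/principal_idealS; exists (q n).
  exists N => n Nn; apply/(principal_ideal_invertible (c n.+1)).
  by rewrite -cq !NP // ltnW.
(* Only the first generator is changed, so that the chain starts exactly at
   [b]. *)
pose c' n := if n is m.+1 then c m.+1 else b.
have c'c n : principal_ideal op (c' n) = principal_ideal op (c n).
  by case: n.
have /choice[q qP] n : exists q, c' n = op (c' n.+1) q.
  by apply/principal_idealS; rewrite !c'c.
case: (bP c' q) => // N NP; exists N => n Nn.
rewrite -(subnK Nn) -!c'c; elim: (n - N)%N => // m <-.
rewrite (qP (m + N)%N); apply/esym/principal_ideal_invertible/NP.
exact: leq_addl.
Qed.

Lemma satisfies_ACCP_divides b d :
  divides op d b -> satisfies_ACCP op b -> satisfies_ACCP op d.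
Proof.
case=> u bdu /satisfies_ACCPP bP; apply/satisfies_ACCPP => c q c0 cq.
pose c' n := if n is m.+1 then c m else b.
pose q' n := if n is m.+1 then q m else u.
case: (bP c' q') => [//|[|n]|N NP]; [by rewrite /= c0|exact: cq|].
by exists N => n Nn; apply: (NP n.+1); rewrite leqW.
Qed.

Lemma invertibleM u v : invertible op (op u v) -> invertible op u.
Proof. by case=> w uvw; exists (op v w); rewrite opA. Qed.

Lemma atom_mul_invertible a u :
  atom op a -> invertible op u -> atom op (op a u).
Proof.
case=> aN aP [u' uu']; split=> [/invertibleM//|v w avw].
have /aP[vV|/invertibleM wV] : a = op v (op w u'); [|by left|by right].
by rewrite opA -avw -opA uu' opx1.
Qed.

Definition product_of_atoms x :=
  exists2 s : seq T, (forall a, a \in s -> atom op a) & x = \big[op/e]_(a <- s) a.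

Lemma atom_product_of_atoms a : atom op a -> product_of_atoms a.
Proof.
by move=> aP; exists [:: a]; rewrite ?big_seq1 // => b; rewrite inE => /eqP->.
Qed.

Lemma product_of_atomsM x y :
  product_of_atoms x -> product_of_atoms y -> product_of_atoms (op x y).
Proof.
case=> s sP -> [t tP ->]; exists (s ++ t); last by rewrite big_cat.
by move=> a; rewrite mem_cat => /orP[/sP|/tP].
Qed.

(** The unit is absorbed into one of the atoms; there is one, as the empty
   product would leave the unit alone. *)
Lemma product_of_atoms_mul_invertible x u :
  product_of_atoms x -> invertible op u -> ~ invertible op (op x u) ->
  product_of_atoms (op x u).
Proof.
case=> -[|a s] sP ->; first by rewrite big_nil op1x.
move=> uV _; exists (op a u :: s); last first.
  by rewrite !big_cons -!opA (opC u).
move=> b; rewrite inE => /predU1P[->|sb]; last by apply: sP; rewrite inE sb orbT.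
by apply: atom_mul_invertible => //; apply: sP; rewrite inE eqxx.
Qed.

(** A noninvertible element that is not a product of atoms has a proper divisor
   of the same kind; iterating yields a chain that never stabilizes. *)
Lemma satisfies_ACCP_product_of_atoms b :
  satisfies_ACCP op b -> ~ invertible op b -> product_of_atoms b.
Proof.
move=> /satisfies_ACCPP bP bN; apply: contrapT => bA.
pose bad x := ~ invertible op x /\ ~ product_of_atoms x.
have /choice[f fP] x : exists p, bad x ->
    [/\ bad p.1, x = op p.1 p.2 & ~ invertible op p.2].
  have [[xN xA]|xG] := pselect (bad x); last by exists (x, x).
  suff [y [z [xyz yN zN yB]]] : exists y z, [/\ x = op y z,
      ~ invertible op y, ~ invertible op z & ~ product_of_atoms y].
    by exists (y, z).
  apply: contrapT => xP; apply/xA/atom_product_of_atoms.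
  split=> // y z xyz; apply: contrapT => /not_orP[yN zN]; apply: xP.
  have [yA|yA] := pselect (product_of_atoms y); last by exists y, z.
  have [zA|zA] := pselect (product_of_atoms z).
    by case: xA; rewrite xyz; apply: product_of_atomsM.
  by exists z, y; rewrite (opC z).
pose c n := iter n (fun x => (f x).1) b.
have cB n : bad (c n) by elim: n => // n /fP[].
case: (bP c (fun n => (f (c n)).2)) => // [n|N /(_ N (leqnn N))].
  by case: (fP _ (cB n)).
by case: (fP _ (cB N)).
Qed.

End CancellativeMonoid.

(** * Supports in the monoid ring *)

(** The pigeonhole step of Koenig's lemma: for each element that fails at some
   stage take such a stage; no element of [s] survives the largest of them. *)
Lemma seq_exists_forall (I : eqType) (s : seq I) (P : I -> nat -> Prop) :
  (forall x n, P x n.+1 -> P x n) ->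
  (forall n, exists2 x, x \in s & P x n) ->
  exists2 x, x \in s & forall n, P x n.
Proof.
move=> PS sP; apply: contrapT => sN.
have /choice[N NP] x : exists n, x \in s -> ~ P x n.
  have [sx|sx] := boolP (x \in s); last by exists 0%N.
  suff [n nP] : exists n, ~ P x n by exists n.
  by apply/existsNP => xP; apply: sN; exists x.
have [x sx] := sP (\max_(x <- s) N x)%N.
have : (N x <= \max_(x <- s) N x)%N by apply: leq_bigmax_seq.
elim: (\max_(_ <- _) _)%N => [|n IH].
  by rewrite leqn0 => /eqP nx; rewrite -nx; apply: NP.
rewrite leq_eqVlt => /predU1P[<-|]; first exact: NP.
by rewrite ltnS => /IH{}IH /PS.
Qed.

Section MonoidRingSupport.
Context (D : idomainType) (K : realType) (M : positive_monoid K).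
Implicit Types (a b d : exponent M) (f g h : monoid_ring D M).

Local Notation addM := (+%R : Monoid.com_law (0 : exponent M)).

Lemma exponent_addI a : injective (addM a).
Proof.
by move=> b c /(congr1 val); rewrite !raddfD /= => /addrI /val_inj.
Qed.

Lemma exponent_invertible a : invertible addM a -> a = 0.
Proof. by case=> b /exponent_add_eq0[]. Qed.

Lemma divides_val a b : divides addM a b -> val a <= val b :> K.
Proof. by case=> c ->; rewrite raddfD /= lerDl (pm_ge0 (valP c)). Qed.

Lemma divides_anti a b : divides addM a b -> val b <= val a :> K -> a = b.
Proof. by move=> /divides_val ab ba; apply/val_inj/le_anti/andP. Qed.

Lemma divides_trans a b c :
  divides addM a b -> divides addM b c -> divides addM a c.
Proof. by case=> x -> [y ->]; exists (x + y); rewrite /= addrA. Qed.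

(** In a sum [b + c = a] with [c] in the support of [g], [c] divides [a], so
   [c = a] and [b = 0]: a single product contributes to the coefficient. *)
Lemma mcoeffM_minimal f g a :
  (forall b, b \in msupp g -> divides addM b a -> b = a) ->
  (f * g)@_a = f@_(0 : exponent M) * g@_a.
Proof.
move=> amin.
rewrite (@mcoeffMlw _ _ (0 |` msupp f)%fset (a |` msupp g)%fset);
  try exact: fsubsetU1.
rewrite (big_fsetD1 0) ?fset1U1 //= (big_fsetD1 a) ?fset1U1 //=.
have -> : mmul (0 : exponent M) a = a by exact: add0r.
rewrite eqxx mulr1n big1_seq ?addr0 => [|b]; last first.
  move=> /= /fsetD1P[ba _]; case: eqP => // ab.
  by case/eqP: ba; rewrite -[b]add0r.
rewrite big1_seq ?addr0 // => b /= /fsetD1P[b0 _].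
rewrite big1_seq // => c /= ca; case: eqP => // bca.
case/eqP: b0; move/fset1UP: ca => [ca|/amin ca].
  apply: (@exponent_addI a); rewrite /= addr0 addrC -{1}ca; exact: bca.
apply: (@exponent_addI a); rewrite /= addr0 addrC -[in b + a]ca ?bca //.
by exists b; rewrite /= addrC -bca.
Qed.

(** Divisibility refines the order of the reals, so that a divisor of least
   real value in the finite support is minimal for divisibility. *)
Lemma exists_minimal_divisor g a : a \in msupp g ->
  exists2 b, b \in msupp g & divides addM b a /\
    forall c, c \in msupp g -> divides addM c b -> c = b.
Proof.
move=> ga; pose P (i : msupp g) := `[< divides addM (val i) a >].
have Pa : P [` ga]%fset by apply/asboolP; exists 0; rewrite /= addr0.
case: (arg_minP (fun i : msupp g => val (val i) : K) Pa) => b /asboolP ba bmin.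
exists (val b); [exact: valP|split=> // c gc cb].
apply: (divides_anti cb); apply: (bmin [` gc]%fset).
exact/asboolP/(divides_trans cb).
Qed.

(** Koenig's lemma.  A state [(k, a)] is good when every partial product starting
   at [h k] has an exponent dividing [a]; as [h k] has finitely many exponents,
   one of them can be removed from [a] so as to leave a good state
   [(k.+1, a')].  In the result [c n] is what remains of [a] after [n] steps. *)
Lemma msupp_prod_chain (h : nat -> monoid_ring D M) a :
  (forall n, exists2 b,
    b \in msupp (\prod_(0 <= i < n) h i) & divides addM b a) ->
  exists c x : nat -> exponent M, [/\ c 0%N = a,
    forall n, c n = c n.+1 + x n & forall n, x n \in msupp (h n)].
Proof.
pose good k a := forall n,
  exists2 b, b \in msupp (\prod_(k <= i < k + n) h i) & divides addM b a.
have goodS k c : good k c -> exists x (c' : exponent M),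
    [/\ x \in msupp (h k), c = c' + x & good k.+1 c'].
  move=> cP.
  pose P x n := exists2 c', c = c' + x & exists2 b,
    b \in msupp (\prod_(k.+1 <= i < k.+1 + n) h i) & divides addM b c'.
  have [x n [c' cc' [b]]|n|x hx xP] := @seq_exists_forall _ (msupp (h k)) P.
  - rewrite addnS big_nat_recr ?leq_addr //= => /msuppM_le[b1 [b2 [b1P _ ->]]].
    move=> b12; exists c' => //; exists b1 => //.
    by apply: divides_trans b12; exists b2.
  - have [b] := cP n.+1; rewrite big_ltn ?addnS ?ltnS ?leq_addr // -addSn.
    move=> /msuppM_le[x [b' [hx b'P ->]]] [y cE].
    exists x => //; exists (b' + y); last by exists b' => //; exists y.
    by rewrite cE [RHS]addrC addrA.
  (* By cancellation the remainder is the same for all [n]. *)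
  have [c' cc' _] := xP 0%N; exists x, c'; split=> // n.
  have [c'' cc'' [b bP bc]] := xP n; exists b => //.
  suff -> : c' = c'' by [].
  by apply: (@exponent_addI x); rewrite /= addrC -cc' addrC -cc''.
move=> aP.
have /choice[f fP] (p : nat * exponent M) : exists q : exponent M * exponent M,
    good p.1 p.2 ->
    [/\ q.1 \in msupp (h p.1), p.2 = q.2 + q.1 & good p.1.+1 q.2].
  have [/goodS[x [c' xc']]|] := pselect (good p.1 p.2); last by exists (p.2, p.2).
  by exists (x, c').
pose c := fix c n := if n is m.+1 then (f (m, c m)).2 else a.
have cP n : good n (c n) by elim: n => // n /(fP (_, _))[].
exists c, (fun n => (f (n, c n)).1); split=> // n.
  by have [] := fP (n, c n) (cP n).
by have [] := fP (n, c n) (cP n).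
Qed.

Lemma malgU1M a b : (<< (a + b)%R >> : monoid_ring D M) = << a >> * << b >>.
Proof.
by rewrite malgME !msuppU1 !big_seq_fset1 !mcoeffUU mulr1.
Qed.

Lemma malgU1_0 : (<< (0 : exponent M) >> : monoid_ring D M) = 1.
Proof. by []. Qed.

Lemma malgU1_neq0 a : (<< a >> : monoid_ring D M) != 0.
Proof. by rewrite monalgU_eq0 oner_neq0. Qed.

Lemma malgU1_factor d f : (forall a, a \in msupp f -> divides addM d a) ->
  exists g, f = << d >> * g.
Proof.
move=> dP; have /choice[q qP] a : exists b, a \in msupp f -> a = d + b.
  have [fa|fa] := boolP (a \in msupp f); last by exists 0.
  by have [b ->] := dP _ fa; exists b.
exists (\sum_(a <- msupp f) << f@_a *g q a >>).
rewrite {1}[f]monalgE mulr_sumr !big_seq; apply: eq_bigr => a fa.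
rewrite malgME msuppU1 msuppU mcoeff_eq0 fa big_seq_fset1 /=.
rewrite big_seq_fset1 !mcoeffUU mul1r; congr << _ *g _ >>; exact: qP.
Qed.

Lemma msupp_malgU1M d f a : d + a \in msupp (<< d >> * f) -> a \in msupp f.
Proof.
case/msuppM_le => b [c [+ fc]]; rewrite msuppU1 inE => /eqP-> dac.
suff -> : a = c by [].
exact: exponent_addI dac.
Qed.

End MonoidRingSupport.

(** * Localizations of domains and their nonzero elements *)

Section Localization.
Context (D : idomainType) (S : multiplicative_subset D).
Implicit Types (f g s : D) (x y u : localization S).

Lemma tofrac_localization f : localization_pred S (FracField.tofrac f).
Proof.
have [S1 _] := ms_closed S.
by apply/asboolP; exists f, 1; rewrite S1 rmorph1 divr1.
Qed.

Definition to_localization f : localization S :=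
  exist (fun r => localization_pred S r) _ (tofrac_localization f).

Lemma to_localizationM : {morph to_localization : f g / f * g}.
Proof. by move=> f g; apply: val_inj; rewrite rmorphM /= rmorphM. Qed.

Lemma to_localization1 : to_localization 1 = 1.
Proof. by apply: val_inj; rewrite /= rmorph1. Qed.

Lemma to_localization_inj : injective to_localization.
Proof. by move=> f g /(congr1 val) /eqP; rewrite tofrac_eq => /eqP. Qed.

Lemma to_localization_eq0 f : (to_localization f == 0) = (f == 0).
Proof. by rewrite -(inj_eq val_inj) rmorph0 /= tofrac_eq0. Qed.

Lemma to_localization_unit s :
  s \in ms_pred S -> to_localization s \is a GRing.unit.
Proof.
move=> Ss.
have sV : localization_pred S (FracField.tofrac s)^-1.
  by apply/asboolP; exists 1, s; rewrite rmorph1 div1r.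
apply/unitrPr; exists (exist (fun r => localization_pred S r) _ sV); apply: val_inj.
by rewrite rmorphM rmorph1 /= divff ?(ms_frac_neq0 Ss).
Qed.

Lemma localizationE x :
  exists f s, s \in ms_pred S /\ x * to_localization s = to_localization f.
Proof.
have /asboolP[f [s [Ss xfs]]] := valP x; exists f, s; split=> //.
by apply: val_inj; rewrite rmorphM /= xfs divfK ?(ms_frac_neq0 Ss).
Qed.

Lemma localization_numerator x :
  exists f u, u \is a GRing.unit /\ x = to_localization f * u.
Proof.
have [f [s [/to_localization_unit sU xs]]] := localizationE x.
exists f, (to_localization s)^-1; rewrite unitrV; split=> //.
by rewrite -xs mulrK.
Qed.

Lemma to_localization_factor f g x : to_localization f = to_localization g * x ->
  exists s p, s \in ms_pred S /\ s * f = p * g.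
Proof.
have [p [s [Ss xs]]] := localizationE x => fgx; exists s, p; split=> //.
by apply: to_localization_inj; rewrite !to_localizationM fgx -xs; ring.
Qed.

End Localization.

Section NonzeroMonoidOfDomain.
Context (D : idomainType).
Implicit Types x y : nonzero D.

Lemma nonzero_mulI x : injective (nonzero_mul x).
Proof.
by move=> y z /(congr1 val) /(mulfI (valP x)) /val_inj.
Qed.

Fact unit_neq0 (u : D) : u \is a GRing.unit -> u != 0.
Proof. by apply: contraTneq => ->; rewrite unitr0. Qed.

Definition nonzero_unit (u : D) (uU : u \is a GRing.unit) : nonzero D :=
  exist (fun r => r != 0) u (unit_neq0 uU).

Lemma invertible_nonzero x :
  invertible (@nonzero_mul D) x <-> val x \is a GRing.unit.
Proof.
split=> [[y /(congr1 val) /= xy]|/unitrPr[y xy]].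
  by apply/unitrPr; exists (val y).
have y0 : y != 0 by apply: contra_eq_neq xy => ->; rewrite mulr0 eq_sym oner_neq0.
by exists (exist (fun r => r != 0) y y0); apply: val_inj.
Qed.

End NonzeroMonoidOfDomain.

(** * The localization at nonzero constant terms *)

Section LocalizedMonoidRing.
Context (D : idomainType) (K : realType) (M : positive_monoid K).
Implicit Types (a b d : exponent M) (f g : monoid_ring D M).

Local Notation addM := (+%R : Monoid.com_law (0 : exponent M)).
Local Notation L := (localization (nonzero_constant_term D M)).
Local Notation loc := (to_localization (nonzero_constant_term D M)).
Local Notation mulL := (@nonzero_mul L : Monoid.com_law (nonzero_one L)).

Lemma in_nonzero_constant_term f :
  (f \in ms_pred (nonzero_constant_term D M)) = ((0 : exponent M) \in msupp f).
Proof. by rewrite -mcoeff_neq0. Qed.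

Lemma loc_unit f : (0 : exponent M) \in msupp f -> loc f \is a GRing.unit.
Proof. by rewrite -in_nonzero_constant_term; exact: to_localization_unit. Qed.

(** Multiplying [f] by some [s] with [s(0) <> 0] may kill the coefficient of [a],
   but not that of a divisor of [a] that is minimal in the support of [f]. *)
Lemma msupp_divides f g (x : L) a : loc f = loc g * x -> a \in msupp f ->
  exists2 b, b \in msupp g & divides addM b a.
Proof.
move=> /to_localization_factor[s [p []]].
rewrite in_nonzero_constant_term => s0 sfpg.
case/exists_minimal_divisor => b fb [ba bmin].
have : b \in msupp (s * f).
  by rewrite -mcoeff_neq0 mcoeffM_minimal // mulf_neq0 // mcoeff_neq0.
rewrite sfpg => /msuppM_le[b1 [b2 [_ gb2 bE]]]; exists b2 => //.
by apply: divides_trans ba; exists b1; rewrite /= addrC bE.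
Qed.

(** An infinite chain of divisors of [f] induces one of divisors of [a], through
   the exponents of the successive quotients; a zero exponent makes the
   corresponding quotient a unit. *)
Lemma msupp_ACCP (y : nonzero L) f a : val y = loc f ->
  a \in msupp f -> satisfies_ACCP addM a -> satisfies_ACCP mulL y.
Proof.
move=> yf fa aP; apply/(satisfies_ACCPP (@nonzero_mulI L)) => c q c0 cq.
have /choice[h /choice[u huP]] n : exists h u,
    u \is a GRing.unit /\ val (q n) = loc h * u.
  exact: localization_numerator.
have prodP n : exists2 b,
    b \in msupp (\prod_(0 <= i < n) h i) & divides addM b a.
  suff [x fx] : exists x, loc f = loc (\prod_(0 <= i < n) h i) * x.
    exact: (msupp_divides fx).
  suff [x fx] : exists x, loc f = loc (\prod_(0 <= i < n) h i) * x * val (c n).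
    by exists (x * val (c n)); rewrite mulrA.
  elim: n => [|n [x ->]].
    by exists 1; rewrite big_geq // to_localization1 !mul1r c0.
  exists (x * u n); rewrite big_nat_recr //= to_localizationM cq /=.
  by rewrite (huP n).2; ring.
have [d [x [d0 dx hx]]] := msupp_prod_chain prodP.
have /(satisfies_ACCPP (@exponent_addI K M))/(_ d x d0 dx)[N NP] := aP.
exists N => n /NP/exponent_invertible xn; apply/invertible_nonzero.
by rewrite (huP n).2 unitrM (huP n).1 loc_unit // -xn.
Qed.

Fact loc_malgU1_neq0 a : loc << a >> != 0.
Proof. by rewrite to_localization_eq0 malgU1_neq0. Qed.

Definition monomial a : nonzero L :=
  exist (fun r => r != 0) (loc << a >>) (loc_malgU1_neq0 a).

Lemma monomial0 : monomial 0 = nonzero_one L.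
Proof. by apply: val_inj; rewrite /= malgU1_0 to_localization1. Qed.

Lemma monomialD a b : monomial (a + b) = mulL (monomial a) (monomial b).
Proof. by apply: val_inj; rewrite /= malgU1M to_localizationM. Qed.

(** If [x * y = X^a] with numerators [f] and [g], then some sum of an exponent of
   [f] and one of [g] divides [a]; since [a] is an atom, one of them is [0]. *)
Lemma atom_monomial a : atom addM a -> atom mulL (monomial a).
Proof.
case=> aN aP; split=> [[y /(congr1 val) /= ay]|x y /(congr1 val) /= axy].
  have [||b] := @msupp_divides 1 << a >> (val y) 0.
  - by rewrite to_localization1.
  - by rewrite -mcoeff_neq0 mcoeff1 eqxx oner_neq0.
  rewrite msuppU1 inE => /eqP-> [c ac].
  by apply: aN; exists c.
have [f [u [uU xE]]] := localization_numerator (val x).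
have [g [v [vU yE]]] := localization_numerator (val y).
have [||b] := @msupp_divides << a >> (f * g) (u * v) a.
- by rewrite axy xE yE to_localizationM; ring.
- by rewrite msuppU1 inE.
case/msuppM_le=> b1 [b2 [fb1 gb2 ->]] [c abc].
have [||/exponent_invertible b20] := aP (b1 + c) b2.
- by rewrite abc /= addrAC.
- case=> d /exponent_add_eq0[/exponent_add_eq0[b10 _] _].
  by left; apply/invertible_nonzero; rewrite xE unitrM uU loc_unit -?b10.
- by right; apply/invertible_nonzero; rewrite yE unitrM vU loc_unit -?b20.
Qed.

Lemma monomial_product_of_atoms a :
  atomic addM -> product_of_atoms mulL (monomial a).
Proof.
move=> aM; have [s sP ->] : product_of_atoms addM a.
  have [/exponent_invertible->|/aM//] := pselect (invertible addM a).
  by exists [::]; rewrite ?big_nil.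
exists (map monomial s); last first.
  by rewrite big_map (big_morph _ monomialD monomial0).
by move=> _ /mapP[b /sP bP ->]; apply: atom_monomial.
Qed.

(** A common divisor [d] of all the exponents of all the numerators can be
   factored out of every element of [S] as [X^d]; the exponent [a] such that
   [d + a] is one of these exponents remains in the support of the cofactor. *)
Lemma exists_ACCP_cofactor (S : set (nonzero L)) : weak_ACCP addM ->
  finite_set S -> S !=set0 ->
  exists2 d, (forall x, S x -> divides mulL (monomial d) x) &
  exists x y, [/\ S x, x = mulL (monomial d) y & satisfies_ACCP mulL y].
Proof.
move=> [_ MP] Sfin [x0 Sx0].
have /choice[num /choice[u numP]] (x : nonzero L) : exists f u,
    u \is a GRing.unit /\ val x = loc f * u.
  exact: localization_numerator.
have num0 x : num x != 0.
  apply: contraTneq (valP x) => n0.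
  by rewrite (numP x).2 n0 negbK mulf_eq0 to_localization_eq0 eqxx.
have [||d dP [s [a [[x Sx xs] sda aP]]]] :=
    MP (\bigcup_(x in S) [set` msupp (num x)]).
- by apply: bigcup_finite => // x _; exact: finite_fset.
- have [k kP] : exists k, k \in msupp (num x0).
    by apply/fset0Pn; rewrite msupp_eq0.
  by exists k, x0.
have cofactorP z : S z -> exists g y, [/\ num z = << d >> * g, val y = loc g &
    z = mulL (monomial d) (mulL y (nonzero_unit (numP z).1))].
  move=> Sz; have [g zg] : exists g, num z = << d >> * g.
    by apply: malgU1_factor => k kz; apply: dP; exists z.
  have g0 : loc g != 0.
    rewrite to_localization_eq0; apply: contraNneq (num0 z) => g0.
    by rewrite zg g0 mulr0.
  exists g, (exist (fun r => r != 0) _ g0); split=> //; apply: val_inj => /=.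
  by rewrite (numP z).2 zg to_localizationM mulrA.
exists d => [z /cofactorP[g [y [_ _ zE]]]|].
  by exists (mulL y (nonzero_unit (numP z).1)).
have [g [y [xg yg xE]]] := cofactorP x Sx.
exists x, (mulL y (nonzero_unit (numP x).1)); split=> //.
have yP : satisfies_ACCP mulL y.
  apply: (msupp_ACCP yg _ aP); apply: (@msupp_malgU1M _ _ _ d).
  by rewrite -xg -[d + a]sda.
apply: (satisfies_ACCP_divides (@nonzero_mulI L) _ yP).
have /invertible_nonzero[v uv] :
    val (nonzero_unit (numP x).1) \is a GRing.unit.
  exact: (numP x).1.
exists v; rewrite [RHS](esym (nonzero_mulA _ _ _)) uv.
by apply: val_inj; rewrite /= mulr1.
Qed.

End LocalizedMonoidRing.

Theorem theorem5p6 (R : idomainType) (K : realType) (M : positive_monoid K) :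
  weak_ACCP (+%R : Monoid.com_law (0 : exponent M)) ->
  weak_ACCP_domain (localization (nonzero_constant_term R M)).
Proof.
move=> MP; split=> [x xN|S Sfin S0]; last first.
  have [d dP xP] := exists_ACCP_cofactor MP Sfin S0.
  by exists (monomial R d).
have [|d _ [_ [y [-> xy yP]]]] := exists_ACCP_cofactor MP (finite_set1 x).
  by exists x.
have dA := monomial_product_of_atoms R d MP.1.
rewrite xy in xN *.
have [yU|yN] := pselect (invertible (@nonzero_mul _) y).
  exact: product_of_atoms_mul_invertible.
apply: product_of_atomsM => //.
exact: satisfies_ACCP_product_of_atoms (@nonzero_mulI _) _ yP yN.
Qed.
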